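(* Let $k\ge2$ be an integer, and let $H(u)=\frac{u+1}{u-1}$, $\lambda_k(z) = \frac14\left[k^2-(k-2)^2H^2(z)\right]$. For $z$ in a sufficiently small neighborhood of the origin, let $t\mapsto(z_k(t),f_k(t))$ be the local solution of the characteristic system $$z_k'(t) = z_k(t)\left[1+2\lambda_k(z_k(t))f_k(t)\right],\quad z_k(0)=z,$$ $$f_k'(t) = -z_k(t)\,\lambda_k'(z_k(t))\,f_k^2(t),\quad f_k(0) = \frac{z(1-z)}{(k-1-z)(1+z-kz)},$$ and set $y_k(t)=H(z_k(t))$ and $g = \lambda_k(z)f_k(0)^2+f_k(0)$. Then, locally (for $t\ge0$ small enough), $$y_k^2(t) = \frac{1+k^2g}{(1+4(k-1)g)\left[H^2\left(\xi_{2t}\left(\sqrt{1+4(k-1)g}\right)\right)-1\right]+(1+k^2g)},$$ where $\xi_{2t}(u) = e^{tu}\,\frac{1-u}{1+u}$, and $$f_k(t) = \frac{-1+\sqrt{1+4g\,\lambda_k(z_k(t))}}{2\lambda_k(z_k(t))}.$$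
   Context: Square roots are principal determinations. The system is the characteristic system of the partial differential equation $\partial_t\tilde\rho_{t,k}(z) = -z\,\partial_z\left[\tilde\rho_{t,k}(z)+\lambda_k(z)\tilde\rho_{t,k}^2(z)\right]$ with initial condition $\tilde\rho_{0,k}(z) = \frac{z(1-z)}{(k-1-z)(1+z-kz)}$, and $f_k(t)=\tilde\rho_{t,k}(z_k(t))$. Equivalently $\lambda_k(z) = \frac{4(k-1)-k^2\alpha^{-1}(z)}{4(1-\alpha^{-1}(z))}$ with $\alpha^{-1}(z)=\frac{4z}{(1+z)^2}$. *)

(* Defs.v *)
From Stdlib Require Import Reals Lra Lia Psatz.
From Coquelicot Require Import Coquelicot.

Local Open Scope C_scope.

Definition Cexp (z : C) : C :=
  RtoC (exp (Re z)) * ((cos (Im z), sin (Im z)) : C).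

(** Principal square root, with branch cut along the negative reals;
    [Csqrt_sqr] and [Csqrt_principal] characterize it. *)
Definition Csqrt (z : C) : C :=
  (sqrt ((Cmod z + Re z) / 2),
   (if Rlt_dec (Im z) 0 then -1 else 1) * sqrt ((Cmod z - Re z) / 2))%R.

Lemma Csqrt_sqr (z : C) : Csqrt z * Csqrt z = z.
Proof.
destruct z as [a b].
assert (Hm : (Cmod (a, b) * Cmod (a, b) = a * a + b * b)%R).
{ unfold Cmod; simpl fst; simpl snd; rewrite sqrt_sqrt; [ring | nra]. }
pose proof (Cmod_ge_0 (a, b)) as Hp.
unfold Csqrt, Cmult; simpl Re; simpl Im; simpl fst; simpl snd.
set (m := Cmod (a, b)) in *.
assert (Ha : (0 <= (m + a) / 2)%R) by nra.
assert (Hb : (0 <= (m - a) / 2)%R) by nra.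
pose proof (sqrt_sqrt _ Ha) as Sa; pose proof (sqrt_sqrt _ Hb) as Sb.
assert (Sab : (sqrt ((m + a) / 2) * sqrt ((m - a) / 2) = Rabs b / 2)%R).
{ rewrite <- sqrt_mult by assumption.
  replace ((m + a) / 2 * ((m - a) / 2))%R with (Rsqr (b / 2))
    by (unfold Rsqr; nra).
  rewrite sqrt_Rsqr_abs; unfold Rdiv; rewrite Rabs_mult.
  now rewrite (Rabs_pos_eq (/ 2)) by lra. }
destruct (Rlt_dec b 0) as [H | H]; f_equal.
- nra.
- rewrite Rabs_left in Sab by assumption; nra.
- nra.
- rewrite Rabs_pos_eq in Sab by lra; nra.
Qed.

Lemma Csqrt_principal (z : C) :
  (0 < Re (Csqrt z) \/ Re (Csqrt z) = 0 /\ 0 <= Im (Csqrt z))%R.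
Proof.
destruct (sqrt_pos ((Cmod z + Re z) / 2)) as [H | H]; [left; exact H | right].
split; [now symmetry |].
pose proof (Csqrt_sqr z) as E; apply (f_equal snd) in E.
unfold Csqrt, Cmult, Re, Im in *; simpl fst in *; simpl snd in *.
destruct (Rlt_dec (snd z) 0) as [Hz | Hz].
- rewrite <- H in E; nra.
- rewrite Rmult_1_l; apply sqrt_pos.
Qed.

Definition H (u : C) : C := (u + 1) / (u - 1).

Definition lambda (k : nat) (z : C) : C :=
  (INR k ^ 2 - (INR k - 2) ^ 2 * H z ^ 2) / 4.

Definition rho0 (k : nat) (z : C) : C :=
  z * (1 - z) / ((INR k - 1 - z) * (1 + z - INR k * z)).

(** Normalized so that [xi (2 * t) u = Cexp (t * u) * ((1 - u) / (1 + u))]. *)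
Definition xi (s : R) (u : C) : C :=
  Cexp (RtoC (s / 2) * u) * ((1 - u) / (1 + u)).

(** [f] has derivative [l] at [t] along [D]; for [D = [0, T)] this is the
    two-sided derivative on [(0, T)] and the right derivative at [0]. *)
Definition is_derive_within (D : R -> Prop) (f : R -> C) (t : R) (l : C) :
  Prop :=
  filterdiff (K := R_AbsRing) (U := R_NormedModule) (V := C_R_NormedModule)
    f (within D (locally t)) (fun h : R => scal h l).

(** [C_derive] is the complex derivative; [lambda k] is differentiable
    except at [1]. *)
Definition is_characteristic_solution
    (k : nat) (z : C) (T : R) (zk fk : R -> C) : Prop :=
  zk 0%R = z /\ fk 0%R = rho0 k z /\
  forall t : R, (0 <= t < T)%R ->
    is_derive_within (fun s => 0 <= s < T)%R zk t
      (zk t * (1 + 2 * lambda k (zk t) * fk t)) /\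
    is_derive_within (fun s => 0 <= s < T)%R fk t
      (- zk t * C_derive (lambda k) (zk t) * fk t ^ 2).

(* Main.v *)
(** Write [w = 1 + 2 lambda f] and [y = H z]. Along a characteristic
    [g = lambda f^2 + f] is conserved, so [w^2 = 1 + 4 g lambda]; since [w] stays
    in the right half-plane it is the principal root, which gives [f].
    With [s^2 = 1 + 4 (k - 1) g], the quotient [u = w / y] solves the Riccati
    equation [u' = (s^2 - u^2) / 2], linearized by the Moebius map:
    [N = (u + s) / (u - s)] satisfies [N' = s N]. Initially [w = (1 + z) / (1 - z)],
    that is [u = -1], hence [N = xi (2 t) s] and [H (xi (2 t) s) = w / (s y)];
    eliminating [w] gives [y^2].
    The solution is prolonged linearly to negative times, so that all
    derivatives at [t = 0] are two-sided. *)

Require Import Defs.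
From Stdlib Require Import Reals Lra.
From Coquelicot Require Import Coquelicot.

Local Open Scope C_scope.

(** * Calculus of complex-valued functions of a real variable *)

(** Splitting into real and imaginary parts lets the real differentiation rules and the mean value
    theorem apply to each component. *)
Definition cderive (f : R -> C) (t : R) (l : C) : Prop :=
  is_derive (fun s => fst (f s)) t (fst l) /\
  is_derive (fun s => snd (f s)) t (snd l).

Lemma cderive_const (c : C) (t : R) : cderive (fun _ => c) t 0.
Proof. split; apply @is_derive_const. Qed.

Lemma cderive_eq (f : R -> C) (t : R) (l l' : C) :
  cderive f t l -> l = l' -> cderive f t l'.
Proof. now intros Hf <-. Qed.

Lemma cderive_plus (f g : R -> C) (t : R) (lf lg : C) :
  cderive f t lf -> cderive g t lg ->
  cderive (fun s => f s + g s) t (lf + lg).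
Proof. intros [Hf Hf'] [Hg Hg']; split; now apply @is_derive_plus. Qed.

Lemma cderive_mult (f g : R -> C) (t : R) (lf lg : C) :
  cderive f t lf -> cderive g t lg ->
  cderive (fun s => f s * g s) t (lf * g t + f t * lg).
Proof.
intros [Hf Hf'] [Hg Hg']; split; simpl.
- evar_last.
  + apply @is_derive_minus; apply Derive.is_derive_mult; eassumption.
  + unfold minus, plus, opp; simpl; ring.
- evar_last.
  + apply @is_derive_plus; apply Derive.is_derive_mult; eassumption.
  + unfold plus; simpl; ring.
Qed.

Lemma cderive_sqr (f : R -> C) (t : R) (l : C) :
  cderive f t l -> cderive (fun s => f s ^ 2) t (2 * l * f t).
Proof.
intros Hf; eapply cderive_eq.
- apply cderive_mult; [exact Hf |].
  apply cderive_mult; [exact Hf | apply cderive_const].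
- simpl; ring.
Qed.

Lemma cderive_opp (f : R -> C) (t : R) (l : C) :
  cderive f t l -> cderive (fun s => - f s) t (- l).
Proof. intros [Hf Hf']; split; now apply @is_derive_opp. Qed.

Lemma cderive_minus (f g : R -> C) (t : R) (lf lg : C) :
  cderive f t lf -> cderive g t lg ->
  cderive (fun s => f s - g s) t (lf - lg).
Proof. intros Hf Hg; apply cderive_plus; [| apply cderive_opp]; assumption. Qed.

Lemma C_neq_0_sum_sqr (z : C) : z <> 0 <-> (fst z ^ 2 + snd z ^ 2 <> 0)%R.
Proof.
destruct z as [a b]; simpl fst; simpl snd; split; intros Hz E; apply Hz.
- unfold RtoC; f_equal; nra.
- injection E as -> ->; ring.
Qed.

Lemma cderive_inv (f : R -> C) (t : R) (l : C) :
  cderive f t l -> f t <> 0 -> cderive (fun s => / f s) t (- (l * (/ f t * / f t))).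
Proof.
intros [Hf Hf'] Hn; apply C_neq_0_sum_sqr in Hn.
(* The components of [/ f] are [fst f] and [- snd f] divided by the squared modulus, so the real
   quotient rule suffices once the latter is differentiated. *)
assert (Hd : is_derive (fun s => fst (f s) ^ 2 + snd (f s) ^ 2)%R t
  (2 * fst (f t) * fst l + 2 * snd (f t) * snd l)%R).
{ evar_last.
  - apply @is_derive_plus; apply is_derive_pow; eassumption.
  - unfold plus; simpl; ring. }
assert (Hm : is_derive (fun s => - snd (f s))%R t (- snd l)%R)
  by now apply @is_derive_opp.
split; simpl.
- evar_last.
  + apply is_derive_div; [apply Hf | apply Hd | apply Hn].
  + simpl; field; simpl in Hn; nra.
- evar_last.
  + apply is_derive_div; [apply Hm | apply Hd | apply Hn].
  + simpl; field; simpl in Hn; nra.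
Qed.

Lemma cderive_div (f g : R -> C) (t : R) (lf lg : C) :
  cderive f t lf -> cderive g t lg -> g t <> 0 ->
  cderive (fun s => f s / g s) t ((lf * g t - f t * lg) / g t ^ 2).
Proof.
intros Hf Hg Hn; eapply cderive_eq.
- apply cderive_mult; [apply Hf | apply cderive_inv; [apply Hg | exact Hn]].
- cbv beta; field; exact Hn.
Qed.

Lemma cderive_Cexp (s : C) (t : R) :
  cderive (fun t => Cexp (RtoC t * s)) t (s * Cexp (RtoC t * s)).
Proof.
destruct s as [a b]; unfold Cexp; split; simpl; auto_derive; trivial;
  unfold Rminus; ring.
Qed.

Lemma Cexp_0 : Cexp 0 = 1.
Proof. unfold Cexp; simpl; rewrite exp_0, cos_0, sin_0; apply Cmult_1_l. Qed.

(** The mean value theorem fails for complex values, so it is applied to the real and imaginary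
    parts separately. *)
Lemma cderive_zero_constant (f : R -> C) (e : R) :
  (forall t, (0 <= t < e)%R -> cderive f t 0) ->
  forall t, (0 <= t < e)%R -> f t = f 0%R.
Proof.
intros Hf t Ht.
assert (K : forall p : R -> R,
  (forall t, (0 <= t < e)%R -> is_derive p t 0%R) -> p t = p 0%R).
{ intros p Hp.
  destruct (MVT_gen p 0 t (fun _ => 0%R)) as [c [_ Hc]];
    rewrite ?Rmin_left, ?Rmax_right by lra.
  - intros x Hx; apply Hp; lra.
  - intros x Hx; apply continuity_pt_filterlim.
    apply (@ex_derive_continuous R_AbsRing R_NormedModule).
    exists 0%R; apply Hp; lra.
  - lra. }
rewrite (surjective_pairing (f t)), (surjective_pairing (f 0%R)).
f_equal; [apply (K (fun s => fst (f s))) | apply (K (fun s => snd (f s)))];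
  intros u Hu; now apply Hf.
Qed.

Lemma cderive_locally_neq_0 (f : R -> C) (t : R) (l : C) :
  cderive f t l -> f t <> 0 -> locally t (fun s => f s <> 0).
Proof.
intros [Hf Hf'] Hn.
assert (Hc : continuous (fun s => fst (f s) ^ 2 + snd (f s) ^ 2)%R t).
{ apply (@ex_derive_continuous R_AbsRing R_NormedModule).
  eexists; apply @is_derive_plus; apply is_derive_pow; eassumption. }
apply C_neq_0_sum_sqr in Hn.
apply (filter_imp (fun s => fst (f s) ^ 2 + snd (f s) ^ 2 <> 0)%R).
- intros s; apply C_neq_0_sum_sqr.
- exact (Hc _ (open_neq 0%R _ Hn)).
Qed.

Lemma cderive_locally_Re_pos (f : R -> C) (t : R) (l : C) :
  cderive f t l -> (0 < Re (f t))%R -> locally t (fun s => 0 < Re (f s))%R.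
Proof.
intros [Hf _] Hn.
assert (Hc : continuous (fun s => fst (f s)) t).
{ apply (@ex_derive_continuous R_AbsRing R_NormedModule); eexists; apply Hf. }
exact (Hc _ (open_gt 0%R _ Hn)).
Qed.

(* Coquelicot's [C_lim] is a limit along the horizontal line through the point. *)
Lemma C_derive_horizontal (f : C -> C) (z l : C) :
  cderive (fun x => f (x, snd z)) (fst z) l -> C_derive f z = l.
Proof.
destruct z as [a b]; simpl fst; simpl snd; intros [Hf Hf'].
assert (K : forall (p : R -> R) (q : R -> R) (d : R), is_derive p a d ->
  (forall x, x <> a -> q x = ((p x - p a) / (x - a))%R) -> real (Lim q a) = d).
{ intros p q d Hp Hq; apply (f_equal real (y := Finite d)).
  apply is_lim_unique, is_lim_spec; intros eps.
  apply is_derive_Reals in Hp.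
  destruct (Hp eps (cond_pos eps)) as [dl Hdl].
  exists dl; intros x Hx Hxa; rewrite (Hq x Hxa).
  replace (p x) with (p (a + (x - a)))%R by (f_equal; ring).
  apply Hdl; [lra | exact Hx]. }
unfold C_derive, C_lim; rewrite (surjective_pairing l); f_equal.
- apply (K (fun x => fst (f (x, b)))); [exact Hf |].
  (* Complex division by the real number [x - a] creates the denominator [(x - a) ^ 2]. *)
  intros x Hx; pose proof (pow2_gt_0 (x - a) ltac:(lra)).
  simpl; field; split; nra.
- apply (K (fun x => snd (f (x, b)))); [exact Hf' |].
  intros x Hx; pose proof (pow2_gt_0 (x - a) ltac:(lra)).
  simpl; field; split; nra.
Qed.

(** * From one-sided to two-sided derivatives *)

(** For [t > 0] the extension agrees with [f] near [t]. At [0] the right side is controlled by the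
    hypothesis, and on the left the affine piece has slope exactly [l 0]. *)
Lemma is_derive_left_extension (T : R) (f l : R -> R) :
  (forall t, (0 <= t < T)%R ->
    filterdiff f (within (fun s => 0 <= s < T)%R (locally t))
      (fun h : R => scal h (l t))) ->
  forall t, (0 <= t < T)%R ->
  is_derive (fun s => if Rle_dec 0 s then f s else f 0 + s * l 0)%R t (l t).
Proof.
intros Hf t Ht; split; [apply is_linear_scal_l |].
intros x Hx.
apply (@is_filter_lim_locally_unique R_AbsRing R_NormedModule) in Hx.
subst x; intros eps.
destruct (Hf t Ht) as [_ K].
assert (Hlim : is_filter_lim (within (fun s => 0 <= s < T)%R (locally t)) t).
{ intros P; unfold within; apply filter_imp; auto. }
specialize (K t Hlim eps); unfold within in K.
assert (HT : locally t (fun y => y < T)%R) by (apply open_lt; lra).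
destruct (Rle_lt_or_eq_dec 0 t (proj1 Ht)) as [H0 | <-].
- assert (Hpos : locally t (fun y => 0 < y)%R) by (apply open_gt; lra).
  generalize (filter_and _ _ K (filter_and _ _ HT Hpos)); apply filter_imp.
  intros y (Ky & Hy & Hy').
  destruct (Rle_dec 0 y), (Rle_dec 0 t); try lra; apply Ky; lra.
- generalize (filter_and _ _ K HT); apply filter_imp; intros y (Ky & Hy).
  destruct (Rle_dec 0 0); [| lra].
  destruct (Rle_dec 0 y) as [Hy' | Hy']; [apply Ky; lra |].
  (* For [y < 0] the linearization error vanishes identically. *)
  match goal with |- (norm ?a <= _)%R => replace a with (@zero R_NormedModule) end.
  + rewrite norm_zero; apply Rmult_le_pos; [left; apply cond_pos | apply norm_ge_0].
  + unfold zero, minus, plus, opp, scal, mult; simpl; unfold mult; simpl; ring.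
Qed.

Lemma is_derive_within_extension (T : R) (f l : R -> C) :
  (forall t, (0 <= t < T)%R ->
    is_derive_within (fun s => 0 <= s < T)%R f t (l t)) ->
  exists F : R -> C, (forall t, (0 <= t)%R -> F t = f t) /\
    forall t, (0 <= t < T)%R -> cderive F t (l t).
Proof.
intros Hf.
exists (fun s => if Rle_dec 0 s then f s else f 0%R + RtoC s * l 0%R); split.
{ intros t Ht; destruct (Rle_dec 0 t); [reflexivity | contradiction]. }
assert (Hfst : forall t, (0 <= t < T)%R ->
  filterdiff (fun s => fst (f s)) (within (fun s => 0 <= s < T)%R (locally t))
    (fun h : R => scal h (fst (l t)))).
{ intros t Ht.
  apply (filterdiff_comp (W := R_NormedModule) f fst _ fst (Hf t Ht)).
  apply filterdiff_linear, is_linear_fst. }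
assert (Hsnd : forall t, (0 <= t < T)%R ->
  filterdiff (fun s => snd (f s)) (within (fun s => 0 <= s < T)%R (locally t))
    (fun h : R => scal h (snd (l t)))).
{ intros t Ht.
  apply (filterdiff_comp (W := R_NormedModule) f snd _ snd (Hf t Ht)).
  apply filterdiff_linear, is_linear_snd. }
intros t Ht; split.
- eapply is_derive_ext;
    [| apply (is_derive_left_extension T (fun s => fst (f s)) (fun s => fst (l s)))];
    try assumption.
  intros s; simpl; destruct (Rle_dec 0 s); simpl; ring.
- eapply is_derive_ext;
    [| apply (is_derive_left_extension T (fun s => snd (f s)) (fun s => snd (l s)))];
    try assumption.
  intros s; simpl; destruct (Rle_dec 0 s); simpl; ring.
Qed.

(** * Nonvanishing criteria and the principal root *)

Lemma RtoC_neq_0 (x : R) : x <> 0%R -> RtoC x <> 0.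
Proof. intros Hx E; apply Hx, RtoC_inj, E. Qed.

Lemma Cinv_neq_0 (z : C) : z <> 0 -> / z <> 0.
Proof. intros Hz E; apply C1_nz; rewrite <- (Cinv_l z Hz), E; ring. Qed.

Ltac C_neq :=
  repeat split; try assumption; try (apply RtoC_neq_0; lra);
  try (apply Cminus_eq_contra; assumption).

Lemma Cexp_neq_0 (z : C) : Cexp z <> 0.
Proof.
apply Cmult_neq_0.
- apply RtoC_neq_0, Rgt_not_eq, exp_pos.
- intros E; injection E as E1 E2.
  pose proof (sin2_cos2 (Im z)) as E3; rewrite E1, E2 in E3.
  unfold Rsqr in E3; lra.
Qed.

(** [(Csqrt c - w) * (Csqrt c + w)] vanishes, while its second factor has positive real part because
    a principal root has nonnegative real part. *)
Lemma Csqrt_unique (w c : C) : w * w = c -> (0 < Re w)%R -> Csqrt c = w.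
Proof.
intros Hw Hre.
assert (E : (Csqrt c - w) * (Csqrt c + w) = 0).
{ replace ((Csqrt c - w) * (Csqrt c + w)) with (Csqrt c * Csqrt c - w * w)
    by ring.
  rewrite Csqrt_sqr, Hw; ring. }
assert (Hs : Csqrt c + w <> 0).
{ intros E'; apply (f_equal Re) in E'.
  change (Re (Csqrt c) + Re w = 0)%R in E'.
  pose proof (Csqrt_principal c); lra. }
replace (Csqrt c) with ((Csqrt c - w) * (Csqrt c + w) / (Csqrt c + w) + w)
  by (field; exact Hs).
rewrite E; field; exact Hs.
Qed.

Lemma C_1_plus_scaled_neq_0 (c : R) (g : C) :
  (0 <= c)%R -> (c * Cmod g < 1)%R -> 1 + RtoC c * g <> 0.
Proof.
intros Hc Hg E.
assert (E' : RtoC c * g = - (1)) by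
  (replace (RtoC c * g) with (1 + RtoC c * g - 1) by ring; rewrite E; ring).
apply (f_equal Cmod) in E'.
rewrite Cmod_mult, Cmod_opp, Cmod_R, Cmod_1, Rabs_pos_eq in E' by exact Hc.
lra.
Qed.

(** * Derivatives of [H] and [lambda] *)

Lemma cderive_H (p : R -> C) (t : R) (l : C) :
  cderive p t l -> p t <> 1 ->
  cderive (fun s => H (p s)) t (- (2) * l / (p t - 1) ^ 2).
Proof.
intros Hp Hn; unfold H; eapply cderive_eq.
- apply cderive_div.
  + apply cderive_plus; [exact Hp | apply cderive_const].
  + apply cderive_minus; [exact Hp | apply cderive_const].
  + now apply Cminus_eq_contra.
- cbv beta; field; C_neq.
Qed.

Lemma cderive_lambda_explicit (k : nat) (p : R -> C) (t : R) (l : C) :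
  cderive p t l -> p t <> 1 ->
  cderive (fun s => lambda k (p s)) t
    (l * ((INR k - 2) ^ 2 * H (p t) / (p t - 1) ^ 2)).
Proof.
intros Hp Hn; unfold lambda; eapply cderive_eq.
- apply cderive_div; [| apply cderive_const | C_neq].
  apply cderive_minus; [apply cderive_const |].
  apply cderive_mult; [apply cderive_const |].
  apply cderive_sqr, (cderive_H _ _ _ Hp Hn).
- cbv beta; field; C_neq.
Qed.

Lemma C_derive_lambda (k : nat) (z : C) :
  z <> 1 ->
  C_derive (lambda k) z = (INR k - 2) ^ 2 * H z / (z - 1) ^ 2.
Proof.
intros Hz; apply C_derive_horizontal.
eapply cderive_eq.
(* The horizontal path through [z] has velocity [1], so the chain rule along it yields the complex
   derivative. *)
- apply (cderive_lambda_explicit k (fun x => (x, snd z)) (fst z) 1).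
  + split; simpl; [apply @is_derive_id | apply @is_derive_const].
  + now rewrite <- surjective_pairing.
- rewrite <- surjective_pairing; ring.
Qed.

Lemma cderive_lambda (k : nat) (p : R -> C) (t : R) (l : C) :
  cderive p t l -> p t <> 1 ->
  cderive (fun s => lambda k (p s)) t (l * C_derive (lambda k) (p t)).
Proof.
intros Hp Hn; rewrite (C_derive_lambda k (p t) Hn).
now apply cderive_lambda_explicit.
Qed.

(** * Evolution along characteristics *)

(** With [w = 1 + 2 lambda F], the derivative is [lambda' Z w F^2 + w F'], and
    [F' = - Z lambda' F^2] cancels it. *)
Lemma characteristic_first_integral (k : nat) (Z F : R -> C) (t : R) :
  Z t <> 1 ->
  cderive Z t (Z t * (1 + 2 * lambda k (Z t) * F t)) ->
  cderive F t (- Z t * C_derive (lambda k) (Z t) * F t ^ 2) ->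
  cderive (fun s => lambda k (Z s) * F s ^ 2 + F s) t 0.
Proof.
intros Z_neq_1 Z_ode F_ode; eapply cderive_eq.
- apply cderive_plus; [| apply F_ode].
  apply cderive_mult; [apply (cderive_lambda k _ _ _ Z_ode Z_neq_1) |].
  apply cderive_sqr, F_ode.
- cbv beta; ring.
Qed.

Lemma cderive_characteristic_speed (k : nat) (Z F : R -> C) (t : R) :
  Z t <> 1 ->
  cderive Z t (Z t * (1 + 2 * lambda k (Z t) * F t)) ->
  cderive F t (- Z t * C_derive (lambda k) (Z t) * F t ^ 2) ->
  cderive (fun s => 1 + 2 * lambda k (Z s) * F s) t
    (2 * Z t * C_derive (lambda k) (Z t) * (lambda k (Z t) * F t ^ 2 + F t)).
Proof.
intros Z_neq_1 Z_ode F_ode; eapply cderive_eq.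
- apply cderive_plus; [apply cderive_const |].
  apply cderive_mult; [| apply F_ode].
  apply cderive_mult; [apply cderive_const |].
  apply (cderive_lambda k _ _ _ Z_ode Z_neq_1).
- cbv beta; ring.
Qed.

(** The function is [(u + s) / (u - s)] for [u = w / y], cleared of the division by [y]; only
    [w - s y] has to be nonzero. *)
Lemma cderive_characteristic_moebius (k : nat) (Z F : R -> C) (t : R)
  (s : C) :
  Z t <> 1 ->
  cderive Z t (Z t * (1 + 2 * lambda k (Z t) * F t)) ->
  cderive F t (- Z t * C_derive (lambda k) (Z t) * F t ^ 2) ->
  s * s = 1 + 4 * (INR k - 1) * (lambda k (Z t) * F t ^ 2 + F t) ->
  1 + 2 * lambda k (Z t) * F t - s * H (Z t) <> 0 ->
  cderive (fun r => (1 + 2 * lambda k (Z r) * F r + s * H (Z r)) /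
                    (1 + 2 * lambda k (Z r) * F r - s * H (Z r))) t
    (s * ((1 + 2 * lambda k (Z t) * F t + s * H (Z t)) /
          (1 + 2 * lambda k (Z t) * F t - s * H (Z t)))).
Proof.
intros Z_neq_1 Z_ode F_ode Hs Hn.
pose proof (cderive_characteristic_speed _ _ _ _ Z_neq_1 Z_ode F_ode) as Hw.
pose proof (cderive_mult _ _ _ _ _ (cderive_const s t)
  (cderive_H _ _ _ Z_ode Z_neq_1)) as Hy.
eapply cderive_eq.
- apply cderive_div; [apply (cderive_plus _ _ _ _ _ Hw Hy)
  | apply (cderive_minus _ _ _ _ _ Hw Hy) | exact Hn].
- cbv beta.
  rewrite C_derive_lambda by exact Z_neq_1.
  set (w := 1 + 2 * lambda k (Z t) * F t) in *.
  set (y := H (Z t)) in *.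
  set (g := lambda k (Z t) * F t ^ 2 + F t) in *.
  set (dw := 2 * Z t * ((INR k - 2) ^ 2 * y / (Z t - 1) ^ 2) * g).
  set (dy := - (2) * (Z t * w) / (Z t - 1) ^ 2).
  (* This is the Riccati equation for [u = w / y], multiplied by [- 2 y^2]. The quotient rule gives
     the numerator [2 s (dy w - dw y)], and [w^2 - s^2 y^2] then cancels one factor [w - s y]. *)
  assert (K : 2 * (dy * w - dw * y) = w * w - s * s * (y * y)).
  { rewrite Hs; unfold dw, dy, w, g, y, lambda, H; field; C_neq. }
  transitivity (s * (2 * (dy * w - dw * y)) / (w - s * y) ^ 2);
    [| rewrite K]; field; exact Hn.
Qed.

(** A nonzero numerator forces a nonzero denominator, so the formula for [y^2] needs no separate
    nonvanishing proof for its denominator. *)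
Lemma Cdiv_eq_of_mult (a b c : C) : a <> 0 -> c * b = a -> c = a / b.
Proof.
intros Ha E.
assert (Hb : b <> 0) by (intros ->; apply Ha; rewrite <- E; ring).
rewrite <- E; field; exact Hb.
Qed.

(** * Initial data near the origin *)

Lemma Cmod_minus_ge (a b : C) : (Cmod a - Cmod b <= Cmod (a - b))%R.
Proof.
pose proof (Cmod_triangle (a - b) b) as T.
replace (a - b + b) with a in T by ring; lra.
Qed.

(** A difference of two squares; its factors are exactly those in the denominator of [rho0], whence
    [lambda k z * rho0 k z = z / (1 - z)]. *)
Lemma lambda_factored (k : nat) (z : C) :
  z <> 1 ->
  lambda k z = (INR k - 1 - z) * (1 + z - INR k * z) / (z - 1) ^ 2.
Proof. intros Hz; unfold lambda, H; field; C_neq. Qed.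

Lemma initial_factors_lower_bound (K : R) (z : C) :
  (2 <= K)%R -> (Cmod z * (8 * K ^ 2) < 1)%R ->
  (/ 2 <= Cmod (RtoC K - 1 - z))%R /\ (/ 2 <= Cmod (1 + z - RtoC K * z))%R.
Proof.
intros HK Hz; pose proof (Cmod_ge_0 z) as H0.
assert (Hz1 : (Cmod z * (K - 1) <= / 16)%R) by nra.
split.
- rewrite <- RtoC_minus.
  eapply Rle_trans; [| apply Cmod_minus_ge].
  rewrite Cmod_R, Rabs_pos_eq by lra; nra.
- replace (1 + z - RtoC K * z) with (1 - RtoC (K - 1) * z)
    by (rewrite RtoC_minus; ring).
  eapply Rle_trans; [| apply Cmod_minus_ge].
  rewrite Cmod_1, Cmod_mult, Cmod_R, Rabs_pos_eq by lra; nra.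
Qed.

Lemma initial_speed (k : nat) (z : C) :
  z <> 1 -> INR k - 1 - z <> 0 -> 1 + z - INR k * z <> 0 ->
  1 + 2 * lambda k z * rho0 k z = - H z.
Proof.
intros Hz H1 H2; rewrite lambda_factored by exact Hz; unfold rho0, H.
field; C_neq.
Qed.

(** [- H] is the Cayley transform [(1 + z) / (1 - z)], whose real part is
    [(1 - |z|^2) / |1 - z|^2]. *)
Lemma Re_opp_H_pos (z : C) : (Cmod z < 1)%R -> (0 < Re (- H z))%R.
Proof.
intros Hz.
assert (Hz' : (fst z ^ 2 + snd z ^ 2 < 1)%R).
{ pose proof (Cmod2_alt z) as E; unfold Re, Im in E; rewrite <- E.
  pose proof (Cmod_ge_0 z); nra. }
destruct z as [a b]; simpl in Hz'.
assert (Hd : (0 < (a - 1) ^ 2 + b ^ 2)%R) by nra.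
replace (Re (- H (a, b))) with ((1 - a ^ 2 - b ^ 2) / ((a - 1) ^ 2 + b ^ 2))%R.
- apply Rdiv_lt_0_compat; [nra | exact Hd].
- unfold H; simpl; field; nra.
Qed.

(** Since [lambda * rho0 + 1 = 1 / (1 - z)], the invariant equals [rho0 / (1 - z)]. The product form
    makes it easy to bound by a multiple of [|z|]. *)
Lemma initial_first_integral (k : nat) (z : C) :
  z <> 1 -> INR k - 1 - z <> 0 -> 1 + z - INR k * z <> 0 ->
  (lambda k z * rho0 k z ^ 2 + rho0 k z) *
    ((INR k - 1 - z) * (1 + z - INR k * z)) = z.
Proof.
intros Hz H1 H2; rewrite lambda_factored by exact Hz; unfold rho0.
field; C_neq.
Qed.

(** Both factors have modulus at least [1/2], so [|g| <= 4 |z|] and [k^2 |g| < 1]. The last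
    condition follows from [4 (k - 1) <= k^2]. *)
Lemma initial_nondegenerate (k : nat) (z : C) :
  (2 <= INR k)%R -> (Cmod z * (8 * INR k ^ 2) < 1)%R ->
  let g := lambda k z * rho0 k z ^ 2 + rho0 k z in
  z <> 1 /\ z <> - (1) /\
  INR k - 1 - z <> 0 /\ 1 + z - INR k * z <> 0 /\ lambda k z <> 0 /\
  1 + INR k ^ 2 * g <> 0 /\ 1 + 4 * (INR k - 1) * g <> 0.
Proof.
intros Hk Hz g.
pose proof (Cmod_ge_0 z) as H0.
assert (Hz1 : z <> 1) by (intros ->; rewrite Cmod_1 in Hz; nra).
assert (Hz2 : z <> - (1)) by (intros ->; rewrite Cmod_opp, Cmod_1 in Hz; nra).
destruct (initial_factors_lower_bound (INR k) z Hk Hz) as [B1 B2].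
assert (H1 : INR k - 1 - z <> 0) by (intros E; rewrite E, Cmod_0 in B1; lra).
assert (H2 : 1 + z - INR k * z <> 0) by (intros E; rewrite E, Cmod_0 in B2; lra).
pose proof (initial_first_integral k z Hz1 H1 H2) as Hg; fold g in Hg.
apply (f_equal Cmod) in Hg; rewrite !Cmod_mult in Hg.
pose proof (Cmod_ge_0 g) as Hg0.
assert (B3 : (/ 4 <= Cmod (RtoC (INR k) - 1 - z) *
  Cmod (1 + z - RtoC (INR k) * z))%R) by nra.
assert (B4 : (Cmod g * / 4 <= Cmod z)%R)
  by (rewrite <- Hg; apply Rmult_le_compat_l; assumption).
assert (B5 : (INR k ^ 2 * Cmod g < 1)%R) by nra.
repeat split; try assumption.
- rewrite lambda_factored by exact Hz1.
  apply Cmult_neq_0; [now apply Cmult_neq_0 |].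
  apply Cinv_neq_0, Cpow_nz, Cminus_eq_contra, Hz1.
- rewrite <- RtoC_pow; apply C_1_plus_scaled_neq_0; [nra | exact B5].
- rewrite <- RtoC_minus, <- RtoC_mult.
  apply C_1_plus_scaled_neq_0; nra.
Qed.

(** * Closed form of the characteristics *)

Theorem mainTheorem9 :
  forall k : nat, (2 <= k)%nat ->
  exists r : R, (0 < r)%R /\
  forall z : C, (Cmod z < r)%R ->
  forall (T : R) (zk fk : R -> C), (0 < T)%R ->
  is_characteristic_solution k z T zk fk ->
  let g := lambda k z * fk 0%R ^ 2 + fk 0%R in
  exists eps : R, (0 < eps <= T)%R /\
  forall t : R, (0 <= t < eps)%R ->
    H (zk t) ^ 2 =
      (1 + INR k ^ 2 * g) /
      ((1 + 4 * (INR k - 1) * g) *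
         (H (xi (2 * t) (Csqrt (1 + 4 * (INR k - 1) * g))) ^ 2 - 1)
       + (1 + INR k ^ 2 * g)) /\
    fk t =
      (- (1) + Csqrt (1 + 4 * g * lambda k (zk t))) / (2 * lambda k (zk t)).
Proof.
intros k Hk2; apply le_INR in Hk2; simpl (INR 2) in Hk2.
assert (Hk : (2 <= INR k)%R) by lra.
exists (/ (8 * INR k ^ 2))%R; split; [apply Rinv_0_lt_compat; nra |].
intros z Hr T zk fk HT (Hzk0 & Hfk0 & Hode) g.
assert (Hz : (Cmod z * (8 * INR k ^ 2) < 1)%R).
{ rewrite <- (Rinv_l (8 * INR k ^ 2)) by nra.
  apply Rmult_lt_compat_r; [nra | exact Hr]. }
assert (Hz1 : (Cmod z < 1)%R) by (pose proof (Cmod_ge_0 z); nra).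
destruct (is_derive_within_extension T zk
  (fun t => zk t * (1 + 2 * lambda k (zk t) * fk t))
  (fun t Ht => proj1 (Hode t Ht))) as (Z & EZ & DZ).
destruct (is_derive_within_extension T fk
  (fun t => - zk t * C_derive (lambda k) (zk t) * fk t ^ 2)
  (fun t Ht => proj2 (Hode t Ht))) as (F & EF & DF).
cbv beta in DZ, DF.
assert (OZ : forall t, (0 <= t < T)%R ->
  cderive Z t (Z t * (1 + 2 * lambda k (Z t) * F t)))
  by (intros t Ht; rewrite EZ, EF by lra; now apply DZ).
assert (OF : forall t, (0 <= t < T)%R ->
  cderive F t (- Z t * C_derive (lambda k) (Z t) * F t ^ 2))
  by (intros t Ht; rewrite EZ, EF by lra; now apply DF).
assert (Z0 : Z 0%R = z) by (rewrite EZ by lra; exact Hzk0).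
assert (F0 : F 0%R = rho0 k z) by (rewrite EF by lra; exact Hfk0).
clear DZ DF Hode Hzk0.
destruct (initial_nondegenerate k z Hk Hz)
  as (N1 & N2 & N3 & N4 & N5 & NA & NS).
rewrite <- Hfk0 in NA, NS; fold g in NA, NS.
assert (I0 : (0 <= 0 < T)%R) by lra.
assert (N1' : Z 0%R <> 1) by (rewrite Z0; exact N1).
assert (W0 : 1 + 2 * lambda k (Z 0%R) * F 0%R = - H (Z 0%R))
  by (rewrite Z0, F0; now apply initial_speed).
(* Four open conditions hold at time [0] and persist by continuity: [Z] avoids [1] and [-1], so that
   [H (Z t)] is defined and nonzero, [lambda] stays nonzero, and [w] stays in the right
   half-plane. *)
assert (Hloc : locally 0%R (fun t =>
  (Z t - 1 <> 0 /\ Z t + 1 <> 0) /\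
  (lambda k (Z t) <> 0 /\ (0 < Re (1 + 2 * lambda k (Z t) * F t))%R))).
{ repeat apply filter_and.
  - apply (cderive_locally_neq_0 (fun t => Z t - 1) _ _
      (cderive_minus _ _ _ _ _ (OZ _ I0) (cderive_const _ _))).
    now apply Cminus_eq_contra.
  - apply (cderive_locally_neq_0 (fun t => Z t + 1) _ _
      (cderive_plus _ _ _ _ _ (OZ _ I0) (cderive_const _ _))).
    rewrite Z0; intros E; apply N2.
    replace z with (z + 1 - 1) by ring; rewrite E; ring.
  - apply (cderive_locally_neq_0 (fun t => lambda k (Z t)) _ _
      (cderive_lambda k _ _ _ (OZ _ I0) N1')).
    rewrite Z0; exact N5.
  - apply (cderive_locally_Re_pos (fun t => 1 + 2 * lambda k (Z t) * F t) _ _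
      (cderive_characteristic_speed k _ _ _ N1' (OZ _ I0) (OF _ I0))).
    rewrite W0, Z0; now apply Re_opp_H_pos. }
destruct Hloc as [d Hd].
set (eps := Rmin d T).
assert (Heps : (0 < eps <= T)%R).
{ unfold eps; split; [apply Rmin_glb_lt; [apply cond_pos | exact HT]
  | apply Rmin_r]. }
exists eps; split; [exact Heps |].
assert (Hnear : forall t, (0 <= t < eps)%R ->
  Z t <> 1 /\ Z t + 1 <> 0 /\ lambda k (Z t) <> 0 /\
  (0 < Re (1 + 2 * lambda k (Z t) * F t))%R).
{ intros t Ht.
  destruct (Hd t) as ((P1 & P2) & P3 & P4).
  - change (Rabs (t - 0) < d)%R; rewrite Rminus_0_r, Rabs_pos_eq by lra.
    pose proof (Rmin_l d T); unfold eps in Ht; lra.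
  - repeat split; try assumption.
    intros E; apply P1; rewrite E; ring. }
assert (HG : forall t, (0 <= t < eps)%R -> lambda k (Z t) * F t ^ 2 + F t = g).
{ intros t Ht; unfold g; rewrite Hfk0, <- F0, <- Z0.
  apply (cderive_zero_constant (fun t => lambda k (Z t) * F t ^ 2 + F t) eps);
    [| exact Ht].
  intros u Hu; apply characteristic_first_integral;
    [now apply Hnear | apply OZ; lra | apply OF; lra]. }
set (s := Csqrt (1 + 4 * (INR k - 1) * g)).
assert (Hs : s * s = 1 + 4 * (INR k - 1) * g) by apply Csqrt_sqr.
assert (Hs0 : s <> 0) by (intros E; apply NS; rewrite <- Hs, E; ring).
(* From here on the choice of root enters only through [0 <= Re s], which rules out [s = -1] and
   gives the sign contradiction in [HQ]. *)
assert (Hsre : (0 <= Re s)%R).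
{ pose proof (Csqrt_principal (1 + 4 * (INR k - 1) * g)) as P; fold s in P; lra. }
clearbody s.
assert (Hs1 : 1 + s <> 0).
{ intros E; apply (f_equal Re) in E; change (1 + Re s = 0)%R in E; lra. }
assert (Hspeed : forall t, (0 <= t < eps)%R ->
  (1 + 2 * lambda k (Z t) * F t) * (1 + 2 * lambda k (Z t) * F t) =
  1 + 4 * g * lambda k (Z t)).
{ intros t Ht; rewrite <- (HG t Ht); ring. }
assert (HQ : forall t, (0 <= t < eps)%R ->
  1 + 2 * lambda k (Z t) * F t - s * H (Z t) <> 0).
{ (* Squaring [w = s y] gives [(1 + k^2 g) (y^2 - 1) = 0], so [Z t = 0], [y = -1]
     and [w = - s], against the signs of the real parts of [w] and [s]. *)
  intros t Ht E.
  destruct (Hnear t Ht) as (P1 & P2 & P3 & P4).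
  pose proof (Hspeed t Ht) as E2.
  assert (Ew : 1 + 2 * lambda k (Z t) * F t = s * H (Z t)).
  { replace (1 + 2 * lambda k (Z t) * F t) with
      (1 + 2 * lambda k (Z t) * F t - s * H (Z t) + s * H (Z t)) by ring.
    rewrite E; ring. }
  rewrite Ew in E2.
  assert (E3 : (1 + INR k ^ 2 * g) * (4 * Z t) = 0).
  { transitivity ((Z t - 1) ^ 2 *
      (s * H (Z t) * (s * H (Z t)) - (1 + 4 * g * lambda k (Z t)))).
    - replace (s * H (Z t) * (s * H (Z t))) with (s * s * H (Z t) ^ 2)
        by (simpl; ring).
      rewrite Hs; unfold lambda, H; field; C_neq.
    - rewrite E2; ring. }
  assert (E4 : Z t = 0).
  { replace (Z t) with ((1 + INR k ^ 2 * g) * (4 * Z t) /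
      ((1 + INR k ^ 2 * g) * 4)) by (field; C_neq).
    rewrite E3; field; C_neq. }
  rewrite Ew, E4 in P4.
  replace (s * H 0) with (- s) in P4.
  - change (Re (- s)) with (- Re s)%R in P4; lra.
  - unfold H; field; rewrite <- RtoC_minus; C_neq. }
intros t Ht.
destruct (Hnear t Ht) as (P1 & P2 & P3 & P4).
pose proof (HQ t Ht) as Qt.
rewrite <- EZ, <- EF by lra.
split.
- set (N := fun r => (1 + 2 * lambda k (Z r) * F r + s * H (Z r)) /
                     (1 + 2 * lambda k (Z r) * F r - s * H (Z r))).
  assert (HN : N t = xi (2 * t) s).
  (* [N] and [Cexp (t s)] solve the same linear equation, so their quotient is constant. *)
  { assert (HC : N t / Cexp (RtoC t * s) = N 0%R / Cexp (RtoC 0 * s)).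
    { apply (cderive_zero_constant (fun r => N r / Cexp (RtoC r * s)) eps);
        [| exact Ht].
      intros u Hu.
      assert (DN : cderive N u (s * N u)).
      { apply (cderive_characteristic_moebius k Z F u s);
          [now apply Hnear | apply OZ; lra | apply OF; lra | | now apply HQ].
        rewrite HG by exact Hu; exact Hs. }
      clearbody N.
      eapply cderive_eq.
      - exact (cderive_div _ _ _ _ _ DN (cderive_Cexp s u) (Cexp_neq_0 _)).
      - cbv beta; field; apply Cexp_neq_0. }
    (* At time [0] one has [w = - y], and the nonzero factor [y] cancels from [N]. *)
    assert (HC0 : N 0%R / Cexp (RtoC 0 * s) = (1 - s) / (1 + s)).
    { replace (RtoC 0 * s) with (RtoC 0) by ring; rewrite Cexp_0.
      unfold N; rewrite W0.
      destruct (Hnear 0%R) as (_ & Q2 & _ & _); [lra |].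
      unfold H; field; C_neq.
      replace (- (Z 0%R + 1) - s * (Z 0%R + 1))
        with (- (1) * ((1 + s) * (Z 0%R + 1))) by ring.
      apply Cmult_neq_0; [| now apply Cmult_neq_0].
      rewrite <- RtoC_opp; C_neq. }
    unfold xi; replace (2 * t / 2)%R with t by field.
    rewrite <- HC0, <- HC; field; apply Cexp_neq_0. }
  rewrite <- HN.
  assert (Hy : H (Z t) <> 0) by (unfold H; apply Cmult_neq_0;
    [exact P2 | apply Cinv_neq_0, Cminus_eq_contra, P1]).
  assert (HHN : H (N t) =
    (1 + 2 * lambda k (Z t) * F t) / (s * H (Z t))).
  { unfold H at 1; unfold N; field; C_neq.
    match goal with |- ?e <> _ => replace e with (2 * (s * H (Z t))) by ring end.
    apply Cmult_neq_0; [C_neq | now apply Cmult_neq_0]. }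
  (* Cleared of its denominator, the claim is [w^2 + (1 + k^2 g - s^2) y^2 = 1 + k^2 g]. Here
     [1 + k^2 g - s^2 = (k - 2)^2 g], and [w^2 = 1 + 4 g lambda] contributes the opposite [y^2]
     term. *)
  apply Cdiv_eq_of_mult; [exact NA |].
  rewrite HHN, <- Hs.
  transitivity ((1 + 2 * lambda k (Z t) * F t) *
    (1 + 2 * lambda k (Z t) * F t) +
    (1 + INR k ^ 2 * g - s * s) * H (Z t) ^ 2); [field; C_neq |].
  rewrite Hspeed by exact Ht; rewrite Hs; unfold lambda; field; C_neq.
(* [w] squares to [1 + 4 g lambda] and has positive real part, so it is the principal root; solving
   [w = 1 + 2 lambda f] gives [f]. *)
- rewrite (Csqrt_unique (1 + 2 * lambda k (Z t) * F t)).
  + field; C_neq.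
  + now apply Hspeed.
  + exact P4.
Qed.
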